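(* Let $\mathbf M$ be an ascending Motzkin path with $m_1=0$ and let $T_{\mathbf M}$, its edge weights and its lattice paths be as defined in the context. Let $1\le k\le r$ and $n\ge k-1$, and put $A_i=(2i-2,0)$, $E_i=(2n+2k-2i,0)$ for $i=1,\dots,k$. Then $$R_{k,n}=(R_{1,0})^k\sum_{(P_1,\dots,P_k)}\prod_{i=1}^k w(P_i),$$ the sum running over all $k$-tuples of $T_{\mathbf M}$-lattice paths such that $P_i$ goes from $A_i$ to $E_i$ and no two of the paths share a vertex, where $w(P)$ is the product of the weights of the steps of $P$. (For $k=1$ this says $R_{1,n}/R_{1,0}$ is the weighted count of $T_{\mathbf M}$-lattice paths from $(0,0)$ to $(2n,0)$.)
   Context: Fix $r\ge1$, $I_r=\{1,\dots,r\}$, and let $(R_{\alpha,n})$ be the $A_r$ $Q$-system: $R_{0,n}=R_{r+1,n}=1$, $R_{\alpha,n+1}R_{\alpha,n-1}=R_{\alpha,n}^2+R_{\alpha+1,n}R_{\alpha-1,n}$ ($\alpha\in I_r$, $n\in\mathbb Z$), viewed as rational functions of $2r$ algebraically independent initial values. An ascending Motzkin path is $\mathbf M=(m_1,\dots,m_r)\in\mathbb Z^r$ with $m_{\alpha+1}-m_\alpha\in\{0,1\}$; here $m_1=0$. Its initial data are $R_{\alpha,m_\alpha},R_{\alpha,m_\alpha+1}$ ($\alpha\in I_r$). Weights: with $\lambda_{\alpha,n}=R_{\alpha,n+1}/R_{\alpha,n}$ and $\mu_{\alpha,n}=R_{\alpha,n}/R_{\alpha-1,n}$ (so $\lambda_{0,n}=\lambda_{r+1,n}=1$),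 and any value for $m_0,m_{r+1}$, set $y_{2\alpha-1}=\lambda_{\alpha,m_\alpha}/\lambda_{\alpha-1,m_{\alpha-1}}$ for $1\le\alpha\le r+1$ and $y_{2\alpha}=\mu_{\alpha+1,m_\alpha+1}/\mu_{\alpha,m_\alpha}$ for $1\le\alpha\le r$. The tree $T_{\mathbf M}$: let $H=\{\alpha\in\{2,\dots,r\}: m_\alpha=m_{\alpha-1}\}$, $s=|H|$, $N=2r+1-s$. It has $2r+1$ edges labelled $1,\dots,2r+1$; edge $2\alpha-1$ with $\alpha\in H$ is called horizontal, all others vertical. The $N$ vertical edges, in increasing order of label, form a path with vertices $v_0,v_1,\dots,v_N$ (the $k$-th vertical edge joins $v_{k-1}$ and $v_k$; $v_k$ has height $k$). For each $\alpha\in H$ the horizontal edge $2\alpha-1$ joins a new leaf vertex to the upper endpoint of edge $2\alpha-2$. Traversing edge $e$ toward $v_0$ (from $v_k$ to $v_{k-1}$, or from a leaf to the chain) has weight $y_e$; traversing it away from $v_0$ has weight $1$. $T_{\mathbf M}$-lattice paths: sequences of lattice points of $\mathbb Z^2$ with heights in $[0,N]$, using steps $(x,h)\to(x+1,h+1)$ (weight $1$, allowed if $h<N$), $(x,h)\to(x+1,h-1)$ (weight $y_e$ for the vertical edge $e$ joining $v_{h-1},v_h$), and $(x,h)\to(x+2,h)$ (allowed only if a horizontal edge $e$ is attached at $v_h$, weight $y_e$). The vertices of a path are the endpoints of its steps. *)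

(* Defs.v *)
From HB Require Import structures.
From mathcomp Require Import all_boot all_order all_algebra.
Set Implicit Arguments. Unset Strict Implicit. Unset Printing Implicit Defensive.
Import Order.TTheory GRing.Theory Num.Theory.
Local Open Scope ring_scope.

(* R a n stands for R_{a,n}; a : nat (only 0..r+1 matter), n : int. *)
Definition QSystem (F : fieldType) (r : nat) (R : nat -> int -> F) : Prop :=
  (forall n : int, R 0%N n = 1 /\ R r.+1 n = 1) /\
  (forall (a : nat) (n : int), (1 <= a <= r)%N ->
     R a (n + 1) * R a (n - 1) = R a n ^+ 2 + R a.+1 n * R a.-1 n).

(* Ascending Motzkin path M = (m_1,...,m_r), with m_1 = 0;
   m is a function nat -> int, only the values m 1, ..., m r matter for
   the hypothesis (the values m 0, m (r+1) are arbitrary, as in the paper). *)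
Definition ascMotzkin (r : nat) (m : nat -> int) : Prop :=
  m 1%N = 0 /\
  forall a : nat, (1 <= a < r)%N -> (m a.+1 == m a) || (m a.+1 == m a + 1).

Section Weights.
Variables (F : fieldType) (R : nat -> int -> F) (m : nat -> int).

Definition lam (a : nat) (n : int) : F := R a (n + 1) / R a n.
Definition mu (a : nat) (n : int) : F := R a n / R a.-1 n.

Definition y_odd (a : nat) : F := lam a (m a) / lam a.-1 (m a.-1).
Definition y_even (a : nat) : F := mu a.+1 (m a + 1) / mu a (m a).

Definition yw (e : nat) : F :=
  if odd e then y_odd (e.+1./2) else y_even (e./2).
End Weights.

Section Tree.
Variables (r : nat) (m : nat -> int).

Definition inH (a : nat) : bool := (2 <= a <= r)%N && (m a == m a.-1).

Definition horiz (e : nat) : bool :=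
  has (fun a => inH a && (e == (a.*2).-1)%N) (iota 0 r.+1).

Definition vert_edges : seq nat := [seq e <- iota 1 (2 * r).+1 | ~~ horiz e].

Definition NN : nat := size vert_edges.

(* label of the h-th vertical edge (joining v_{h-1} and v_h), 1 <= h <= N *)
Definition vedge (h : nat) : nat := nth 0%N vert_edges h.-1.

(* the horizontal edge attached at v_h, if any: edge 2a-1 is attached to the
   upper endpoint of edge 2a-2, which is v_h iff edge 2a-2 is the h-th
   vertical edge *)
Definition hedge_at (h : nat) : option nat :=
  if (0 < h <= NN)%N && horiz (vedge h).+1 then Some (vedge h).+1 else None.
End Tree.

Inductive step := Up | Dn | Fl.
(* Up : (x,h) -> (x+1,h+1); Dn : (x,h) -> (x+1,h-1); Fl : (x,h) -> (x+2,h) *)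

Definition xlen_step (st : step) : nat := if st is Fl then 2 else 1.
Definition xlen (s : seq step) : nat := sumn (map xlen_step s).

Section Paths.
Variables (r : nat) (m : nat -> int).

Fixpoint pvalid (h : nat) (s : seq step) : bool :=
  match s with
  | [::] => true
  | Up :: s' => (h < NN r m)%N && pvalid h.+1 s'
  | Dn :: s' => (0 < h)%N && pvalid h.-1 s'
  | Fl :: s' => (hedge_at r m h != None) && pvalid h s'
  end.

Fixpoint endh (h : nat) (s : seq step) : nat :=
  match s with
  | [::] => h
  | Up :: s' => endh h.+1 s'
  | Dn :: s' => endh h.-1 s'
  | Fl :: s' => endh h s'
  end.

Fixpoint pverts (x h : nat) (s : seq step) : seq (nat * nat) :=
  (x, h) :: match s with
            | [::] => [::]
            | Up :: s' => pverts x.+1 h.+1 s'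
            | Dn :: s' => pverts x.+1 h.-1 s'
            | Fl :: s' => pverts x.+2 h s'
            end.

Fixpoint pweight (F : fieldType) (R : nat -> int -> F) (h : nat) (s : seq step)
  : F :=
  match s with
  | [::] => 1
  | Up :: s' => pweight R h.+1 s'
  | Dn :: s' => yw R m (vedge r m h) * pweight R h.-1 s'
  | Fl :: s' => yw R m (odflt 0%N (hedge_at r m h)) * pweight R h s'
  end.
End Paths.

Fixpoint words (j : nat) : seq (seq step) :=
  if j is j'.+1 then [seq st :: w | st <- [:: Up; Dn; Fl], w <- words j']
  else [:: [::]].

(* all T_M-lattice paths from (a,0) to (b,0), as step sequences
   (every step advances x by >= 1, so at most b-a steps) *)
Definition tpaths (r : nat) (m : nat -> int) (a b : nat) : seq (seq step) :=
  [seq s <- flatten [seq words j | j <- iota 0 (b - a).+1]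
     | [&& (a <= b)%N, xlen s == (b - a)%N, pvalid r m 0 s & endh 0 s == 0%N]].

Fixpoint prodseq (T : Type) (ls : seq (seq T)) : seq (seq T) :=
  if ls is l :: ls' then [seq x :: t | x <- l, t <- prodseq ls'] else [:: [::]].

(* k-tuples (P_1,...,P_k), P_i from A_i = (2i-2,0) to E_i = (2n+2k-2i,0);
   each path is recorded as (starting abscissa, step sequence) *)
Definition path_tuples (r : nat) (m : nat -> int) (k n : nat)
  : seq (seq (nat * seq step)) :=
  prodseq [seq [seq ((2 * i - 2)%N, s)
               | s <- tpaths r m (2 * i - 2) (2 * n + 2 * k - 2 * i)]
          | i <- iota 1 k].

Definition nonintersecting (ps : seq (nat * seq step)) : bool :=
  pairwise (fun p q => all (fun v => v \notin pverts q.1 0 q.2)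
                           (pverts p.1 0 p.2)) ps.

Definition tuple_weight (F : fieldType) (r : nat) (m : nat -> int)
  (R : nat -> int -> F) (ps : seq (nat * seq step)) : F :=
  \prod_(p <- ps) pweight r m R 0 p.2.

(* Main.v *)
Require Import Defs.
From HB Require Import structures.
From mathcomp Require Import all_boot all_order all_algebra.
From mathcomp Require Import perm ring zify.
Set Implicit Arguments. Unset Strict Implicit. Unset Printing Implicit Defensive.
Import Order.TTheory GRing.Theory Num.Theory.
Local Open Scope ring_scope.

(** Read the [R 1 n] as moments.  The Q-system makes the ratios [qq] and [ee] of
    the [R a n] a qd-table, so the monic orthogonal polynomials given by its
    recursion satisfy the usual contiguity relations; applied to the moments
    they form a family [ladder a p t].  Orthogonality puts the Hankel matrix of
    the moments in triangular form, whence [R k n] is a [k * k] Hankel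
    determinant of the [R 1 j].  The contiguity relations are also, vertex by
    vertex, the first-step recursion for lattice paths on the tree, with the
    flat case of the Motzkin path coming from the identity
    [qq - ee = lam / lam]; hence [R 1 n / R 1 0] counts the paths.  The
    determinant of path counts is then turned into a sum over non-intersecting
    tuples by sweeping from left to right: the leftmost current vertex makes a
    step, the determinant is linear in the corresponding row, and it vanishes
    when two current vertices collide.  Planarity is an invariant of the sweep,
    so that no permutation other than the identity ever occurs. *)

(** * The qd-table of a Q-system and its orthogonal polynomials *)

Section Ladder.
Variables (F : fieldType) (r : nat) (R : nat -> int -> F).
Hypothesis qsys : QSystem r R.
Hypothesis R_neq0 : forall (a : nat) (j : int), (1 <= a <= r)%N -> R a j != 0.

Lemma R_neq0_ext a j : (a <= r.+1)%N -> R a j != 0.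
Proof.
move=> ar; case: (posnP a) => [->|a0]; first by rewrite (qsys.1 j).1 oner_eq0.
case: (ltngtP a r.+1) ar => // [ar|->] _; first by rewrite R_neq0 ?a0.
by rewrite (qsys.1 j).2 oner_eq0.
Qed.

Definition qq (a : nat) (p : int) : F :=
  R a.+1 (p + 1) * R a (p - 1) / (R a.+1 p * R a p).
(** The value 0 at [a = 0] and [a = r.+1] encodes R_{-1} = R_{r+2} = 0; the formula itself would
    read [R 0] at [a = 0], as [0.-1 = 0], and the unconstrained [R r.+2] at [a = r.+1]. *)
Definition ee (a : nat) (p : int) : F :=
  if (1 <= a <= r)%N then R a.+1 p * R a.-1 (p - 1) / (R a (p - 1) * R a p)
  else 0.
(** This is [lam R a.+1 p / lam R a p], the future weight of a horizontal edge. *)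
Definition hh (a : nat) (p : int) : F :=
  R a.+1 (p + 1) * R a p / (R a.+1 p * R a (p + 1)).

(** Solve the Q-system relation at [a] for [R a (p - 1)]: the square gives [hh], the product gives
    [ee]. *)
Lemma qq_split_low a p : (a <= r)%N -> qq a p = hh a p + ee a (p + 1).
Proof.
move=> ar; rewrite /qq /hh /ee addrK.
have n1 j : R a.+1 j != 0 by apply: R_neq0_ext.
have n0 j : R a j != 0 by apply: R_neq0_ext; apply: leqW.
case: (posnP a) => [a0|a0].
  rewrite a0 /= addr0; move: n1 n0; rewrite a0 => n1 n0.
  by rewrite !(qsys.1 _).1.
rewrite ar /=.
have E := qsys.2 a p; rewrite a0 ar in E; have {}E := E isT.
have E' : R a (p - 1) = (R a p ^+ 2 + R a.+1 p * R a.-1 p) / R a (p + 1).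
  by rewrite -E mulrC mulKf.
rewrite E'; field; rewrite ?n1 ?n0 //.
Qed.

(** The relation at [a.+1], solved for its largest index. Eliminating [hh] between the two
    splittings yields the additive rhombus rule of the qd-algorithm. *)
Lemma qq_split_high a p : (a <= r)%N -> qq a (p + 1) = hh a p + ee a.+1 (p + 1).
Proof.
move=> ar; rewrite /qq /hh /ee addrK.
have n1 j : R a.+1 j != 0 by apply: R_neq0_ext.
have n0 j : R a j != 0 by apply: R_neq0_ext; apply: leqW.
have [ar'|ar'] := ltnP a r; last first.
  have -> : a = r by apply/eqP; rewrite eqn_leq ar.
  by rewrite !(qsys.1 _).2 /= addr0.
have E := qsys.2 a.+1 (p + 1); rewrite /= ar' addrK in E; have {}E := E isT.
have E' : R a.+1 (p + 1 + 1) =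
    (R a.+1 (p + 1) ^+ 2 + R a.+2 (p + 1) * R a (p + 1)) / R a.+1 p.
  by rewrite -E mulfK.
rewrite /= E'; field; rewrite ?n1 ?n0 //.
Qed.

Lemma qq_ee_rhombus a p : (a <= r)%N -> qq a p * ee a p = qq a.-1 p * ee a (p + 1).
Proof.
move=> ar; rewrite /qq /ee addrK.
case: (posnP a) => [->|a0]; first by rewrite !mulr0.
rewrite ar /= prednK //.
have n1 j : R a.+1 j != 0 by apply: R_neq0_ext.
have n0 j : R a j != 0 by apply: R_neq0_ext; apply: leqW.
have nm j : R a.-1 j != 0 by apply: R_neq0_ext; apply: leq_trans (leq_pred _) (leqW ar).
by field; rewrite ?n1 ?n0 ?nm.
Qed.

(* [ladder a p t] is [\sum_j c_j R 1 (t + p + j)], where the [c_j] are the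
   coefficients of the monic orthogonal polynomial of degree [a] for the moment
   sequence [R 1 (s + j)], [s = p - a]; [qq] and [ee] are the entries of the
   associated qd-table. *)
Fixpoint ladder (a : nat) (p t : int) : F :=
  if a is a'.+1 then
    ladder a' p (t + 1) - qq a' (p - 1) * ladder a' (p - 1) (t + 1)
  else R 1%N (t + p).

Lemma ladder_up a p t :
  ladder a (p + 1) t = ladder a.+1 (p + 1) (t - 1) + qq a p * ladder a p t.
Proof. by rewrite /= !subrK addrK subrK. Qed.

(** While [ladder_up] only unfolds the recursion, this contiguity rests on the rhombus rules: they
    match the coefficients once both terms of the recursion are expanded by induction. *)
Lemma ladder_down a p t : (a <= r.+1)%N ->
  ladder a p t = ladder a (p + 1) (t - 1) + ee a p * ladder a.-1 p t.
Proof.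
elim: a p t => [|a IH] p t ar.
  by rewrite /= /ee /= mul0r addr0; congr (R _ _); ring.
rewrite /= subrK addrK.
have E1 := IH p (t + 1) (ltnW ar).
have E2 := IH (p - 1) (t + 1) (ltnW ar).
have S1 := @qq_split_low a (p - 1) ar.
have S2 := @qq_split_high a (p - 1) ar.
have X := @qq_ee_rhombus a (p - 1) ar.
rewrite subrK in S1 S2 X E2; rewrite addrK in E1 E2.
rewrite E1 E2 S2.
(* Unfolding [ladder] needs [a > 0]; for [a = 0] both sides vanish with [ee]. *)
have U : ee a p * ladder a p t = ee a p *
   (ladder a.-1 p (t + 1) - qq a.-1 (p - 1) * ladder a.-1 (p - 1) (t + 1)).
  by case: (a) => //; rewrite /ee /= !mul0r.
rewrite mulrDr [qq a _ * (_ * _)]mulrA X.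
have -> : ee a p * ladder a.-1 p (t + 1) =
  ee a p * ladder a p t + qq a.-1 (p - 1) * ee a p * ladder a.-1 (p - 1) (t + 1).
  by rewrite U; ring.
rewrite S1; ring.
Qed.

(** Apply [ladder_down] at [a], then [ladder_up], then [ladder_down] at [a.+1]; the coefficient left
    over is [qq a p - ee a.+1 p], which is [hh a (p - 1)]. *)
Lemma ladder_flat a p t : (a < r)%N ->
  ladder a p t = ladder a.+1 p (t - 1) + hh a (p - 1) * ladder a p (t - 1)
                 + ee a p * ladder a.-1 p t.
Proof.
move=> ar; rewrite (@ladder_down a p t) ?(leq_trans (ltnW ar)) //; congr (_ + _).
have := ladder_up a p (t - 1); rewrite (@ladder_down a.+1 p (t - 1)) ?ltnS ?(ltnW ar) // => ->.
have := @qq_split_high a (p - 1) (ltnW ar); rewrite subrK => -> /=.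
ring.
Qed.

(** Orthogonality and norm need a joint induction: at [t = -1] the previous norms cancel thanks to
    the choice of [qq], and this vanishing turns [ladder_down] at 0 into the next norm. *)
Lemma ladder_initial a p : (a <= r)%N ->
  (forall t : int, - (a%:Z) <= t < 0 -> ladder a p t = 0) /\
  ladder a p 0 = R a.+1 p / R a (p - 1).
Proof.
suff: (a <= r)%N -> forall p,
  (forall t : int, - (a%:Z) <= t < 0 -> ladder a p t = 0) /\
  ladder a p 0 = R a.+1 p / R a (p - 1) by move=> /[apply].
elim: a {p} => [|a IH] ar p.
  split; first by move=> t; lia.
  by rewrite /= add0r (qsys.1 _).1 divr1.
have ar' : (a <= r)%N by apply: ltnW.
have vanish q t : - (a.+1%:Z) <= t < 0 -> ladder a.+1 q t = 0.
  move=> tb; have [t1|t1] := eqVneq t (-1); last first.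
    by rewrite /= !(IH ar' _).1 ?mulr0 ?subrr //; lia.
  rewrite /= t1 addNr !(IH ar' _).2 /qq subrK.
  have n1 j : R a.+1 j != 0 by apply: R_neq0_ext; apply: ltnW.
  have n0 j : R a j != 0 by apply: R_neq0_ext; apply: leqW.
  by field; rewrite ?n1 ?n0.
split; first exact: vanish.
rewrite ladder_down ?(leqW ar) // [ladder _ (p + 1) _]vanish ?sub0r; last by lia.
rewrite add0r /= (IH ar' _).2 /ee ar /=.
have n1 j : R a.+1 j != 0 by apply: R_neq0_ext; apply: ltnW.
have n0 j : R a j != 0 by apply: R_neq0_ext; apply: leqW.
by field; rewrite ?n1 ?n0.
Qed.

Lemma ladder_neg a p t : (a <= r)%N -> - (a%:Z) <= t < 0 -> ladder a p t = 0.
Proof. by move=> ar; apply: (@ladder_initial a p ar).1. Qed.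

Lemma ladder0 a p : (a <= r)%N -> ladder a p 0 = R a.+1 p / R a (p - 1).
Proof. by move=> ar; apply: (@ladder_initial a p ar).2. Qed.

(* [ee r.+1 = 0] makes [ladder r.+1 p t] a function of [p + t] only. *)
Lemma ladder_top p t : ladder r.+1 p t = 0.
Proof.
have shift q u : ladder r.+1 q u = ladder r.+1 (q + 1) (u - 1).
  by rewrite ladder_down // /ee ltnn andbF mul0r addr0.
have vanish q : ladder r.+1 q (-1) = 0.
  rewrite /= addNr !ladder0 // /qq subrK.
  have n1 j : R r.+1 j != 0 by apply: R_neq0_ext.
  have n0 j : R r j != 0 by apply: R_neq0_ext.
  by field; rewrite ?n1 ?n0.
have shiftn n q u : ladder r.+1 q u = ladder r.+1 (q + n%:Z) (u - n%:Z).
  elim: n => [|n ->]; first by rewrite addr0 subr0.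
  by rewrite shift; congr ladder; lia.
have [t0|t0] := leP (-1) t.
  rewrite (shiftn (absz (t + 1))).
  by rewrite (_ : t - _ = -1) ?vanish //; lia.
(* Since [shiftn] only lowers the last argument, for [t < -1] the diagonal is followed from its
   entry at -1 down to [t]. *)
rewrite -(vanish (p + t + 1)) (shiftn (absz (t + 1)) (p + t + 1)).
by congr ladder; lia.
Qed.

Lemma ladder_monic a s : exists c : nat -> F, c a = 1 /\
  forall t, ladder a (s + a%:Z) t = \sum_(j < a.+1) c j * R 1%N (t + s + a%:Z + j%:Z).
Proof.
elim: a s => [|a IH] s.
  exists (fun=> 1); split => // t.
  by rewrite big_ord1 mul1r /= !addr0.
have [c [c1 cE]] := IH (s + 1); have [d [d1 dE]] := IH s.
(* [u] is the polynomial at [s + 1] times the variable; [v] is the multiple of the one at [s], cut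
   off beyond degree [a]. *)
pose u (j : nat) := if j is j'.+1 then c j' else 0.
pose v (j : nat) := if (j <= a)%N then qq a (s + a%:Z) * d j else 0.
exists (fun j => u j - v j).
split; first by rewrite /u /v ltnn subr0.
move=> t.
have -> : ladder a.+1 (s + a.+1%:Z) t = ladder a (s + 1 + a%:Z) (t + 1)
   - qq a (s + a%:Z) * ladder a (s + a%:Z) (t + 1).
  have -> : s + a.+1%:Z = s + 1 + a%:Z by lia.
  by rewrite /=; congr (_ - qq _ _ * ladder _ _ _); lia.
rewrite cE dE; under [RHS]eq_bigr => j _ do rewrite mulrBl.
rewrite sumrB; congr (_ - _).
  rewrite [RHS]big_ord_recl mul0r add0r; apply: eq_bigr => j _ /=.
  by congr (_ * R _ _); rewrite /bump /=; lia.
rewrite [RHS]big_ord_recr /= {2}/v ltnn mul0r addr0 mulr_sumr.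
apply: eq_bigr => j _; rewrite /v -ltnS ltn_ord mulrA.
by congr (_ * R _ _); lia.
Qed.

(** Multiplying by the unitriangular matrix [C] of polynomial coefficients leaves, by orthogonality,
    a lower triangular matrix with the norms on its diagonal; their product telescopes. *)
Lemma hankel_det k s : (k <= r)%N ->
  \det (\matrix_(i < k, j < k) R 1%N (s + i%:Z + j%:Z)) = R k (s + k%:Z - 1).
Proof.
move=> kr.
have [c cP] := fin_all_exists (fun a : 'I_k => ladder_monic a s).
pose H := \matrix_(i < k, j < k) R 1%N (s + i%:Z + j%:Z).
pose C := \matrix_(j < k, a < k) if (j <= a)%N then c a j else 0.
pose L := \matrix_(i < k, a < k) ladder a (s + a%:Z) (i%:Z - a%:Z).
have HC : H *m C = L.
  apply/matrixP => i a; rewrite !mxE (cP a).2.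
  rewrite (big_ord_widen k (fun j => c a j * R 1%N (i%:Z - a%:Z + s + a%:Z + j%:Z))) //.
  rewrite [RHS]big_mkcond /=; apply: eq_bigr => j _; rewrite !mxE ltnS.
  case: ifP => _; last by rewrite mulr0.
  by rewrite mulrC; congr (_ * R _ _); lia.
have detC : \det C = 1.
  rewrite -det_tr det_trig.
    by rewrite big1 // => a _; rewrite !mxE leqnn (cP a).1.
  by apply/is_trig_mxP => i j ij; rewrite !mxE leqNgt ij.
have detL : \det L = \prod_(a < k) (R a.+1 (s + a%:Z) / R a (s + a%:Z - 1)).
  rewrite det_trig.
    apply: eq_bigr => a _; rewrite mxE subrr ladder0 //.
    by apply: leq_trans kr; apply: ltnW.
  apply/is_trig_mxP => i j ij; rewrite mxE ladder_neg //; last by lia.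
  by apply: leq_trans kr; apply: ltnW.
have := congr1 determinant HC; rewrite det_mulmx detC mulr1 -/H => ->.
rewrite detL; elim: (k) kr => [|k' IH] kr.
  by rewrite big_ord0 (qsys.1 _).1.
rewrite big_ord_recr /= IH ?(ltnW kr) // mulrC divfK.
  by congr (R _ _); lia.
by apply: R_neq0_ext; apply/leqW/ltnW.
Qed.
End Ladder.

(** * Edge labels along the chain *)

Local Arguments horiz : simpl never.

Section Labels.
Variables (r : nat) (m : nat -> int).

Lemma horizE e : horiz r m e = odd e && inH r m e.+1./2.
Proof.
apply/hasP/andP => [[a _ /andP[aH /eqP->]]|[oe eH]].
  have a2 : (2 <= a)%N by case/andP: aH => /andP[].
  have -> : a.*2.-1.+1 = a.*2 by lia.
  by rewrite doubleK; split=> //; lia.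
exists e.+1./2; last by rewrite eH /=; lia.
by case/andP: eH => /andP[_ ?] _; rewrite mem_iota; lia.
Qed.

Lemma horiz_even a : horiz r m a.*2 = false.
Proof. by rewrite horizE odd_double. Qed.

Lemma horiz_odd a : horiz r m a.*2.+1 = inH r m a.+1.
Proof. by rewrite horizE /= odd_double /= doubleK. Qed.

Lemma horiz_succ e : horiz r m e -> horiz r m e.+1 = false.
Proof. by rewrite !horizE => /andP[/= -> _]. Qed.

(** Horizontal labels are odd, so at most one label is skipped at a time. *)
Definition next_label (e : nat) : nat :=
  if horiz r m e.+1 then e.+2 else e.+1.

Lemma path_vertical b n :
  path (frel next_label) b [seq e <- iota b.+1 n | ~~ horiz r m e].
Proof.
have [k] := ubnP n; elim: k b n => // k IH b [|n] //=; rewrite ltnS => nk.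
have [hb|hb] := boolP (horiz r m b.+1) => /=; last first.
  by rewrite /next_label (negPf hb) eqxx IH.
case: n nk => [|n] nk //=; rewrite horiz_succ //= /next_label hb eqxx /=.
by apply: IH; lia.
Qed.

(** A fictitious edge 0 ending at the root lets height 0 be treated like the others. *)
Definition label (h : nat) : nat := nth 0%N (0%N :: vert_edges r m) h.

Lemma labelS h : (h < NN r m)%N -> label h.+1 = next_label (label h).
Proof. by move=> hN; have /pathP-/(_ 0%N h hN)/eqP := path_vertical 0 (2 * r).+1. Qed.

Lemma label_vedge h : (0 < h)%N -> label h = vedge r m h.
Proof. by case: h. Qed.

Lemma label_mem h : (0 < h <= NN r m)%N ->
  ~~ horiz r m (label h) && (label h <= (2 * r).+1)%N.
Proof.
case: h => // h /= hN; have : label h.+1 \in vert_edges r m by apply: mem_nth.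
by rewrite mem_filter mem_iota => /andP[->]; lia.
Qed.

Lemma label_vertical h : (h <= NN r m)%N -> horiz r m (label h) = false.
Proof.
case: h => [|h] hN; first exact: (horiz_even 0).
by have /andP[/negPf] := @label_mem h.+1 hN.
Qed.

Lemma label_le h : (h <= NN r m)%N -> (label h <= (2 * r).+1)%N.
Proof. by case: h => [|h] hN //; have /andP[_] := @label_mem h.+1 hN. Qed.

Lemma label_lt h : (h < NN r m)%N -> (label h < (2 * r).+1)%N.
Proof.
move=> hN; have := label_le hN; rewrite labelS // /next_label.
by case: ifP => _; lia.
Qed.

Lemma label_top : label (NN r m) = (2 * r).+1.
Proof.
have top : horiz r m (2 * r).+1 = false.
  by rewrite mul2n horiz_odd /inH ltnn andbF.
have E : vert_edges r m = rcons [seq e <- iota 1 (2 * r) | ~~ horiz r m e] (2 * r).+1.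
  by rewrite /vert_edges -(addn1 (2 * r)) (iotaD 1 (2 * r) 1) filter_cat /= addn1 add1n top cats1.
by rewrite /label /NN E size_rcons /= nth_rcons ltnn eqxx.
Qed.

End Labels.

(** * Ladder entries at the vertices of the tree *)

Section Heights.
Variables (F : fieldType) (r : nat) (R : nat -> int -> F) (m : nat -> int).
Hypothesis qsys : QSystem r R.
Hypothesis R_neq0 : forall (a : nat) (j : int), (1 <= a <= r)%N -> R a j != 0.
Hypothesis motz : ascMotzkin r m.

(* Putting [m_0 := -1] makes edge 1 behave like any other vertical odd edge. *)
Definition mext (a : nat) : int := if a is 0%N then -1 else m a.

Lemma mext_vertical a : (a < r)%N -> horiz r m a.*2.+1 = false ->
  mext a.+1 = mext a + 1.
Proof.
case: a => [|a] ar; first by rewrite /= motz.1.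
rewrite horiz_odd /inH ar /= => /negbT ma.
by have := motz.2 a.+1; rewrite ar (negPf ma) /= => /(_ isT)/eqP.
Qed.

Lemma mext_horiz a : horiz r m a.*2.+1 -> mext a.+1 = mext a.
Proof. by rewrite horiz_odd; case: a => [|a] //= /andP[_ /eqP]. Qed.

(* This is [R 1 0] times the weighted count of the paths of length [h + 2 t]
   to the root from the upper endpoint [v_h] of edge [e]. *)
Definition label_sum (e : nat) (t : int) : F :=
  ladder R e./2 (mext e./2 + (if odd e then 2 else 1)) t.

Lemma label_sum_even a t : label_sum a.*2 t = ladder R a (mext a + 1) t.
Proof. by rewrite /label_sum odd_double doubleK. Qed.

Lemma label_sum_odd a t : label_sum a.*2.+1 t = ladder R a (mext a + 2) t.
Proof. by rewrite /label_sum /= odd_double uphalf_double. Qed.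

Lemma yw_even a : (1 <= a <= r)%N -> yw R m a.*2 = ee r R a (mext a + 1).
Proof.
move=> ar; rewrite /yw odd_double doubleK /y_even /mu /ee ar addrK.
by case: a ar => // a _ /=; rewrite !invfM invrK; ring.
Qed.

Lemma lam_mext a : lam R a (m a) = lam R a (mext a).
Proof. by case: a => // [/=]; rewrite /lam !(qsys.1 _).1. Qed.

Lemma yw_vertical a : (a <= r)%N -> horiz r m a.*2.+1 = false ->
  yw R m a.*2.+1 = qq R a (mext a + 1).
Proof.
move=> ar ha; rewrite /yw /= odd_double /= doubleK /y_odd lam_mext.
(* At [a = r] the arbitrary value [m r.+1] drops out because [R r.+1] is constant. *)
have -> : lam R a.+1 (mext a.+1) = lam R a.+1 (mext a + 1).
  have [ar'|ar'] := ltnP a r; first by rewrite mext_vertical.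
  have -> : a = r by apply/eqP; rewrite eqn_leq ar.
  by rewrite /lam !(qsys.1 _).2.
by rewrite /= lam_mext /lam /qq addrK !invfM invrK; ring.
Qed.

Lemma yw_horiz a : horiz r m a.*2.+1 -> yw R m a.*2.+1 = hh R a (mext a).
Proof.
move=> ha; rewrite /yw /= odd_double /= doubleK /y_odd lam_mext mext_horiz //=.
by rewrite lam_mext /lam /hh !invfM invrK; ring.
Qed.

(** The three terms are an up, a down and a flat first step. For [e = 2a] this is [ladder_flat] or
    [ladder_down], according to whether edge [2a + 1] is horizontal; for [e = 2a + 1] it is
    [ladder_up], with [ladder_top] at the last edge. *)
Lemma label_sum_rec e' t : let e := next_label r m e' in
  horiz r m e' = false -> (e <= (2 * r).+1)%N ->
  label_sum e t = (if (e < (2 * r).+1)%N then label_sum (next_label r m e) (t - 1) else 0)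
    + yw R m e * label_sum e' t
    + (if horiz r m e.+1 then yw R m e.+1 * label_sum e (t - 1) else 0).
Proof.
move=> e he' er.
have he : horiz r m e = false.
  by rewrite /e /next_label; case: ifP => // /horiz_succ.
have [a [ea|ea]] : exists a, e = a.*2 \/ e = a.*2.+1.
  exists e./2; rewrite -{1 3}[e]odd_double_half.
  by case: (odd e); [right|left].
- have a0 : (0 < a)%N by rewrite /e /next_label in ea; case: ifP ea => _; lia.
  have ar : (a <= r)%N by lia.
  have -> : (e < (2 * r).+1)%N by lia.
  (* The offsets 1 and 2 in [label_sum] make this uniform: [mext] is constant across a skipped edge
     [2a - 1] and grows by 1 across a vertical one. *)
  have prev : label_sum e' t = ladder R a.-1 (mext a + 1) t.
    rewrite /e /next_label in ea; case: ifP ea => h ea.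
      have e'E : e' = a.-1.*2 by lia.
      move: h; rewrite e'E label_sum_even => /mext_horiz.
      by rewrite prednK // => ->.
    have e'E : e' = a.-1.*2.+1 by lia.
    move: he'; rewrite e'E label_sum_odd => /mext_vertical.
    by rewrite prednK // => -> //; congr ladder; ring.
  rewrite prev {1 2 4 6}ea !label_sum_even ea yw_even ?a0 //= /next_label.
  case: ifP => h.
    have ar' : (a < r)%N by move: h; rewrite horiz_odd /inH; lia.
    rewrite -doubleS label_sum_even yw_horiz // mext_horiz //.
    by rewrite (ladder_flat qsys) // addrK; ring.
  rewrite label_sum_odd (ladder_down qsys) ?(leqW ar) // addr0.
  by congr (ladder _ _ _ _ + _); ring.
have ar : (a <= r)%N by lia.
have e'E : e' = a.*2.
  move: ea; rewrite /e /next_label; case: ifP => h ea; last by lia.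
  by move: h; rewrite horizE; lia.
rewrite ea e'E; rewrite ea in he.
rewrite label_sum_odd label_sum_even yw_vertical // -doubleS horiz_even addr0.
have -> : mext a + 2 = mext a + 1 + 1 by ring.
rewrite (ladder_up R); congr (_ + _).
case: ifP => ar'.
  rewrite /next_label -doubleS horiz_even label_sum_even mext_vertical //; lia.
have -> : a = r by lia.
by rewrite (ladder_top qsys).
Qed.
End Heights.

(** * Weighted counts of lattice paths *)

Definition step_code (st : step) : option bool :=
  match st with Up => Some true | Dn => Some false | Fl => None end.
Definition step_decode (c : option bool) : step :=
  match c with Some true => Up | Some false => Dn | None => Fl end.
Lemma step_codeK : cancel step_code step_decode. Proof. by case. Qed.
HB.instance Definition _ := Equality.copy step (can_type step_codeK).

Section LatticePaths.
Variables (r : nat) (m : nat -> int).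

Definition steps : seq step := [:: Up; Dn; Fl].

Definition step_ok (h : nat) (st : step) : bool :=
  match st with
  | Up => (h < NN r m)%N
  | Dn => (0 < h)%N
  | Fl => hedge_at r m h != None
  end.

Definition step_height (h : nat) (st : step) : nat :=
  match st with Up => h.+1 | Dn => h.-1 | Fl => h end.

Definition move (v : nat * nat) (st : step) : nat * nat :=
  ((v.1 + xlen_step st)%N, step_height v.2 st).

Definition is_path (v : nat * nat) (X : nat) (s : seq step) : bool :=
  [&& (v.1 + xlen s == X)%N, pvalid r m v.2 s & endh v.2 s == 0%N].

Definition short_words (K : nat) : seq (seq step) :=
  flatten [seq words j | j <- iota 0 K].

Definition paths_to (v : nat * nat) (X : nat) : seq (seq step) :=
  [seq s <- short_words X.+1 | is_path v X s].

Lemma is_path_cons v X st s :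
  is_path v X (st :: s) = step_ok v.2 st && is_path (move v st) X s.
Proof.
rewrite /is_path /xlen /= addnA.
by case: st => /=; rewrite ?[_ == X]andbC -?andbA andbCA; do ?[congr (_ && _)]; rewrite andbC.
Qed.

Lemma size_xlen s : (size s <= xlen s)%N.
Proof. by elim: s => //= st s IH; rewrite /xlen /= -/(xlen s); case: st => /=; lia. Qed.

Lemma is_path_height v X s : is_path v X s -> (v.1 + v.2 <= X)%N.
Proof.
case/and3P => /eqP <- _ /eqP es; rewrite leq_add2l.
suff H h : (h <= endh h s + xlen s)%N by have := H v.2; rewrite es.
elim: s h {es} => [|st s IH] h; first by rewrite addn0.
by rewrite /xlen /= -/(xlen s); case: st => /=;
   [have := IH h.+1 | have := IH h.-1 | have := IH h]; lia.
Qed.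

Lemma wordsS j : words j.+1 = flatten [seq [seq st :: w | w <- words j] | st <- steps].
Proof. by []. Qed.

Lemma filter_words_nil (p : pred (seq step)) j :
  (forall s, size s = j -> p s = false) -> [seq s <- words j | p s] = [::].
Proof.
elim: j p => [|j IH] p pF; first by rewrite /= pF.
rewrite wordsS /= !filter_cat !filter_map.
by rewrite !IH // => s ss /=; apply: pF; rewrite /= ss.
Qed.

(** Longer words overshoot [X], as every step advances. The lists agree even in order, so
    enumerations with different length bounds can be identified. *)
Lemma filter_short_words v X K : (X < K + v.1)%N ->
  [seq s <- short_words K | is_path v X s] = paths_to v X.
Proof.
suff H i j : (X < i + v.1)%N -> [seq s <- short_words (i + j) | is_path v X s]
   = [seq s <- short_words i | is_path v X s].
  move=> XK; have [KX|XK'] := leqP K X.+1.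
    by rewrite /paths_to -(subnKC KX) H.
  by rewrite -(subnKC (ltnW XK')) H // ltnS leq_addr.
move=> Xi; elim: j => [|j IH]; first by rewrite addn0.
rewrite -{}IH addnS /short_words -addn1 iotaD map_cat flatten_cat filter_cat /=.
rewrite cats0 filter_words_nil ?cats0 // => s ss.
by apply/negP => /and3P[/eqP sX _ _]; have := size_xlen s; lia.
Qed.

Lemma paths_to_self X : paths_to (X, 0%N) X = [:: [::]].
Proof. by rewrite -(@filter_short_words _ _ 1) //= /is_path /= addn0 eqxx. Qed.

Lemma paths_to_nil v X : (X <= v.1)%N -> v != (X, 0%N) -> paths_to v X = [::].
Proof.
move=> Xv vX; rewrite -(@filter_short_words v X 1) ?add1n ?ltnS //=.
case: ifP => //; rewrite /is_path /= addn0 => /andP[/eqP E1 /eqP E2].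
by move: vX; rewrite -E1 -E2 -surjective_pairing eqxx.
Qed.

Lemma paths_to_short v X : (X < v.1 + v.2)%N -> paths_to v X = [::].
Proof.
move=> Xv; rewrite /paths_to; elim: (short_words _) => //= s l ->.
by case: ifP => // /is_path_height; lia.
Qed.

Lemma paths_to_cons (F : nmodType) (f : seq step -> F) v X : v != (X, 0%N) ->
  \sum_(s <- paths_to v X) f s =
  \sum_(st <- steps | step_ok v.2 st) \sum_(s <- paths_to (move v st) X) f (st :: s).
Proof.
move=> vX; transitivity (\sum_(st <- steps) \sum_(s <- short_words X |
    is_path v X (st :: s)) f (st :: s)); last first.
  rewrite [RHS]big_mkcond; apply: eq_bigr => st _.
  under eq_bigl => s do rewrite is_path_cons.
  case: ifP => _; last by rewrite big_pred0_eq.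
  by rewrite -big_filter filter_short_words //; case: st => /=; lia.
rewrite /paths_to big_filter /short_words big_flatten big_map.
rewrite -[iota 0 X.+1]/(index_iota 0 X.+1) big_nat_recl //=.
rewrite big_mkcond big_seq1 /= ifN ?add0r; last first.
  apply/negP; rewrite /is_path /= addn0 => /andP[/eqP E1 /eqP E2].
  by move: vX; rewrite -E1 -E2 -surjective_pairing eqxx.
under [RHS]eq_bigr => st _ do rewrite big_flatten big_map.
rewrite exchange_big /index_iota subn0 /=; apply: eq_bigr => j _.
by rewrite -[X in \sum_(i <- X | _) _ = _]/(words j.+1) wordsS big_flatten big_map; apply: eq_bigr => st _; rewrite big_map.
Qed.

Variables (F : fieldType) (R : nat -> int -> F).

Definition step_weight (h : nat) (st : step) : F :=
  match st with
  | Up => 1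
  | Dn => yw R m (vedge r m h)
  | Fl => yw R m (odflt 0%N (hedge_at r m h))
  end.

Lemma pweight_cons h st s :
  pweight r m R h (st :: s) = step_weight h st * pweight r m R (step_height h st) s.
Proof. by case: st => //=; rewrite mul1r. Qed.

Definition paths_sum (v : nat * nat) (X : nat) : F :=
  \sum_(s <- paths_to v X) pweight r m R v.2 s.

Lemma paths_sum_self X : paths_sum (X, 0%N) X = 1.
Proof. by rewrite /paths_sum paths_to_self big_seq1. Qed.

Lemma paths_sum_nil v X : (X <= v.1)%N -> v != (X, 0%N) -> paths_sum v X = 0.
Proof. by move=> Xv vX; rewrite /paths_sum paths_to_nil // big_nil. Qed.

Lemma paths_sum_short v X : (X < v.1 + v.2)%N -> paths_sum v X = 0.
Proof. by move=> Xv; rewrite /paths_sum paths_to_short // big_nil. Qed.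

Lemma paths_sum_rec v X : v != (X, 0%N) ->
  paths_sum v X = \sum_(st <- steps | step_ok v.2 st)
                    step_weight v.2 st * paths_sum (move v st) X.
Proof.
move=> vX; rewrite /paths_sum paths_to_cons //; apply: eq_bigr => st _.
by rewrite mulr_sumr; apply: eq_bigr => s _; rewrite pweight_cons.
Qed.

Hypothesis qsys : QSystem r R.
Hypothesis R_neq0 : forall (a : nat) (j : int), (1 <= a <= r)%N -> R a j != 0.
Hypothesis motz : ascMotzkin r m.

Lemma label_sum_neg e : (2 <= e <= (2 * r).+1)%N -> label_sum R m e (-1) = 0.
Proof. by move=> er; rewrite /label_sum (ladder_neg qsys) //; lia. Qed.

Lemma NN_gt0 : (0 < NN r m)%N.
Proof. by have := label_top r m; case: (NN r m) => // [[]]. Qed.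

Lemma label_ge h : (h <= NN r m)%N -> (h <= label r m h)%N.
Proof.
elim: h => // h IH hN; rewrite labelS // /next_label.
by have := IH (ltnW hN); case: ifP => _; lia.
Qed.

(** Both sides obey the same first-step recursion, and every step shortens [h + 2 * t]. At [t = -1]
    one side vanishes by orthogonality, the other because the root is out of reach. *)
Lemma paths_sum_label x h t : (h <= NN r m)%N ->
  R 1%N 0 * paths_sum (x, h) (x + h + 2 * t) = label_sum R m (label r m h) t%:Z.
Proof.
have [d] := ubnP (h + 2 * t)%N; elim: d x h t => // d IH x h t; rewrite ltnS => hd hN.
case: h hd hN => [|h] hd hN.
  case: t hd => [|t] hd.
    rewrite muln0 !addn0 paths_sum_self mulr1 /label_sum /=.
    by congr (R _ _).
  rewrite paths_sum_rec; last by rewrite xpair_eqE; lia.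
  rewrite !big_cons big_nil /= NN_gt0 mul1r addr0 /move /=.
  (* The root allows only an up step, and [label_sum] at label 0 and [t + 1] is the same moment as
     at label 1 and [t]. *)
  rewrite (_ : (x + 0 + _)%N = (x + 1 + 1 + 2 * t)%N); last by lia.
  rewrite IH ?NN_gt0 //; last by lia.
  rewrite labelS ?NN_gt0 // /next_label (_ : horiz r m 1 = false) ?(horiz_odd r m 0) //.
  by rewrite /label_sum /=; congr (R _ _); lia.
rewrite paths_sum_rec; last by rewrite xpair_eqE; lia.
have lS := labelS hN.
have := label_sum_rec qsys R_neq0 motz (e' := label r m h) t%:Z
  (label_vertical (ltnW hN)).
rewrite -lS => /(_ (label_le hN)) ->.
have -> : (label r m h.+1 < (2 * r).+1)%N = (h.+1 < NN r m)%N.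
  have [hN'|hN'] := ltnP h.+1 (NN r m); first by rewrite label_lt.
  by rewrite (_ : h.+1 = NN r m) ?label_top ?ltnn //; lia.
rewrite !big_cons big_nil /= /hedge_at hN /= -label_vedge // /move /=.
have up : (h.+1 < NN r m)%N ->
   R 1%N 0 * paths_sum ((x + 1)%N, h.+2) (x + h.+1 + 2 * t) =
   label_sum R m (next_label r m (label r m h.+1)) (t%:Z - 1).
  move=> hN'; rewrite -labelS //; case: t {hd} => [|t] in hd *.
    rewrite paths_sum_short ?mulr0 ?sub0r ?label_sum_neg //=; last by lia.
    by rewrite label_le // andbT; have := label_ge hN'; lia.
  rewrite (_ : (x + h.+1 + _)%N = (x + 1 + h.+2 + 2 * t)%N); last by lia.
  by rewrite IH //; [congr label_sum|]; lia.
have dn : R 1%N 0 * paths_sum ((x + 1)%N, h) (x + h.+1 + 2 * t) =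
   label_sum R m (label r m h) t%:Z.
  rewrite (_ : (x + h.+1 + _)%N = (x + 1 + h + 2 * t)%N); last by lia.
  by rewrite IH //; lia.
have fl : horiz r m (label r m h.+1).+1 ->
   R 1%N 0 * paths_sum ((x + 2)%N, h.+1) (x + h.+1 + 2 * t) =
   label_sum R m (label r m h.+1) (t%:Z - 1).
  move=> hz; clear up dn; case: t {hd} => [|t] in hd *.
    rewrite paths_sum_short ?mulr0 ?sub0r ?label_sum_neg //=; last by lia.
    (* The label before a horizontal one is even and positive, hence at least 2. *)
    rewrite label_le // andbT; have := label_ge hN.
    by move: hz; rewrite horizE; lia.
  rewrite (_ : (x + h.+1 + _)%N = (x + 2 + h.+1 + 2 * t)%N); last by lia.
  by rewrite IH //; [congr label_sum|]; lia.
rewrite -dn addr0.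
case: ifP => [/up <-|_];
  case: (boolP (horiz r m _)) fl => [_ /(_ isT) <-|_ _] /=; ring.
Qed.

Lemma paths_sum_moment x n :
  R 1%N 0 * paths_sum (x, 0%N) (x + 2 * n) = R 1%N n%:Z.
Proof.
have := @paths_sum_label x 0 n (leq0n _); rewrite addn0 => ->.
by rewrite /label_sum /=; congr (R _ _); lia.
Qed.
End LatticePaths.

(** * Determinants and vertex-disjoint paths *)

Local Arguments pweight : simpl never.

Lemma big_prodseq_cons (V : nmodType) (T : Type) (l : seq T) ls (f : seq T -> V) :
  \sum_(ps <- prodseq (l :: ls)) f ps = \sum_(x <- l) \sum_(t <- prodseq ls) f (x :: t).
Proof. by rewrite /= big_flatten big_map; apply: eq_bigr => x _; rewrite big_map. Qed.

Lemma big_prodseq_cat (V : nmodType) (T : Type) (l1 l2 : seq (seq T)) (f : seq T -> V) :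
  \sum_(ps <- prodseq (l1 ++ l2)) f ps =
  \sum_(a <- prodseq l1) \sum_(b <- prodseq l2) f (a ++ b).
Proof.
elim: l1 f => [|l l1 IH] f; first by rewrite big_seq1.
by rewrite cat_cons !big_prodseq_cons; apply: eq_bigr => x _; rewrite IH.
Qed.

Lemma prodseq_map (T U : Type) (g : T -> U) (ls : seq (seq T)) :
  prodseq [seq map g l | l <- ls] = [seq map g t | t <- prodseq ls].
Proof.
elim: ls => //= l ls ->; rewrite map_flatten -!map_comp; congr flatten.
by apply: eq_map => x /=; rewrite -!map_comp.
Qed.

Lemma pairwise_replace (T : eqType) (e : rel T) (s1 s2 : seq T) x y :
  {in s1, forall z, e z x -> e z y} -> {in s2, forall z, e x z -> e y z} ->
  pairwise e (s1 ++ x :: s2) -> pairwise e (s1 ++ y :: s2).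
Proof.
move=> h1 h2; rewrite !pairwise_cat !pairwise_cons !allrel_consr.
case/and3P => /andP[a1 ->] -> /andP[a2 ->]; rewrite !andbT /=.
by apply/andP; split; apply/allP => z zs; [apply: h1|apply: h2] => //;
   [apply: (allP a1)|apply: (allP a2)].
Qed.

Lemma exists_min (T : Type) (f : T -> nat) (s : seq T) : (0 < size s)%N ->
  exists s1 x s2, s = s1 ++ x :: s2 /\ all (fun y => f x <= f y)%N s.
Proof.
elim: s => // x [|y s] IH _; first by exists [::], x, [::]; rewrite /= leqnn.
have [s1 [z [s2 [E zmin]]]] := IH isT.
have [xz|zx] := leqP (f x) (f z).
  exists [::], x, (y :: s); split=> //; rewrite [all _ _]/= leqnn /=.
  by apply: sub_all zmin => w; apply: leq_trans.
by exists (x :: s1), z, s2; rewrite E; split=> //; rewrite [all _ _]/= ltnW // -E.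
Qed.

Section Determinant.
Variables (r : nat) (m : nat -> int) (F : fieldType) (R : nat -> int -> F).
Implicit Types (v : nat * nat) (p q : nat * nat * seq step).
Implicit Types (c : seq (nat * nat * nat)).

Definition located_verts p : seq (nat * nat) := pverts p.1.1 p.1.2 p.2.
Definition disjoint_paths p q : bool :=
  all (fun v => v \notin located_verts q) (located_verts p).
Definition vertex_disjoint : pred (seq (nat * nat * seq step)) :=
  pairwise disjoint_paths.

Definition located_paths v X : seq (nat * nat * seq step) :=
  [seq (v, s) | s <- paths_to r m v X].
(** An entry [(v, X)] of [c] stands for a path still to be drawn from [v] to [(X, 0)]. *)
Definition located_tuples c : seq (seq (nat * nat * seq step)) :=
  prodseq [seq located_paths e.1 e.2 | e <- c].

Definition disjoint_weight (ps : seq (nat * nat * seq step)) : F :=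
  if vertex_disjoint ps then \prod_(p <- ps) pweight r m R p.1.2 p.2 else 0.
Definition disjoint_sum c : F := \sum_(ps <- located_tuples c) disjoint_weight ps.

Definition paths_det (k : nat) c : F :=
  \det (\matrix_(i < k, j < k)
     paths_sum r m R (nth (0, 0, 0)%N c i).1 (nth (0, 0, 0)%N c j).2).

Lemma disjoint_pathsC p q : disjoint_paths p q = disjoint_paths q p.
Proof.
by apply/allP/allP => H v vq; apply/negP => vp; have := H v vp; rewrite vq.
Qed.

Lemma located_verts_cons v st s :
  located_verts (v, st :: s) = v :: located_verts (move v st, s).
Proof. by case: v => x h; case: st; rewrite /located_verts /move /= ?addn1 ?addn2. Qed.

Lemma mem_start p : p.1 \in located_verts p.
Proof.
by case: p => [[x h] [|[] s]]; rewrite /located_verts /= mem_head.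
Qed.

(** Abscissas strictly increase along a path. *)
Lemma notin_verts v p : (v.1 <= p.1.1)%N -> v != p.1 -> v \notin located_verts p.
Proof.
case: p => [u s] /=; elim: s u => [|st s IH] u vu ne.
  by case: u vu ne => x h vu ne; rewrite /located_verts /= inE.
rewrite located_verts_cons inE negb_or ne /=; apply: IH.
  by rewrite /=; lia.
by apply: contraNneq ne => E; move: vu; rewrite E; case: (st) => /=; lia.
Qed.

Lemma located_tuples_start c ps :
  ps \in located_tuples c -> map fst ps = map fst c.
Proof.
elim: c ps => [|e c IH] ps /=; first by rewrite inE => /eqP ->.
by case/allpairsP => -[p t] /= [/mapP[s _ ->] /IH <- ->].
Qed.

Lemma disjoint_sum_split c1 e c2 : disjoint_sum (c1 ++ e :: c2) =
  \sum_(a <- located_tuples c1) \sum_(s <- paths_to r m e.1 e.2)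
     \sum_(b <- located_tuples c2) disjoint_weight (a ++ (e.1, s) :: b).
Proof.
rewrite /disjoint_sum /located_tuples map_cat big_prodseq_cat.
by apply: eq_bigr => a _; rewrite big_prodseq_cons big_map.
Qed.

Lemma disjoint_sum_collision c : ~~ uniq (map fst c) -> disjoint_sum c = 0.
Proof.
move=> nu; rewrite /disjoint_sum big_seq big1 // => ps /located_tuples_start E.
rewrite /disjoint_weight; case: ifP => // di; move: nu; rewrite -E uniq_pairwise.
rewrite pairwise_map (sub_pairwise _ di) // => p q /allP/(_ _ (mem_start p)).
by rewrite /=; apply: contraNneq => ->; apply: mem_start.
Qed.

Lemma paths_det_collision k c : size c = k -> ~~ uniq (map fst c) -> paths_det k c = 0.
Proof.
move=> sc /(uniqPn (0, 0)%N)[i [j [ij]]]; rewrite size_map sc => jk E.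
have ik := ltn_trans ij jk.
apply: (@determinant_alternate _ _ _ (Ordinal ik) (Ordinal jk)).
  by rewrite -val_eqE /= neq_ltn ij.
move=> l; rewrite !mxE /=; congr paths_sum.
by rewrite !(nth_map (0, 0, 0)%N) ?sc in E.
Qed.

(** No other path visits [v], so dropping it changes no intersection. *)
Lemma disjoint_weight_cons a b v st s :
  {in a ++ b, forall q, v \notin located_verts q} ->
  disjoint_weight (a ++ (v, st :: s) :: b) =
  step_weight r m R v.2 st * disjoint_weight (a ++ (move v st, s) :: b).
Proof.
move=> fresh; rewrite /disjoint_weight.
have E q : q \in a ++ b ->
    disjoint_paths (v, st :: s) q = disjoint_paths (move v st, s) q.
  by move=> qa; rewrite /disjoint_paths located_verts_cons /= fresh.
have -> : vertex_disjoint (a ++ (v, st :: s) :: b)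
        = vertex_disjoint (a ++ (move v st, s) :: b).
  by apply/idP/idP; apply: pairwise_replace => q qa;
     rewrite ?[disjoint_paths q _]disjoint_pathsC E // mem_cat qa ?orbT.
case: ifP => _; last by rewrite mulr0.
rewrite !big_cat !big_cons /= pweight_cons; ring.
Qed.

Lemma disjoint_sum_rec c1 v X c2 : v != (X, 0)%N ->
  {in c1 ++ c2, forall e, (v.1 <= e.1.1)%N && (v != e.1)} ->
  disjoint_sum (c1 ++ (v, X) :: c2) =
  \sum_(st <- steps | step_ok r m v.2 st)
     step_weight r m R v.2 st * disjoint_sum (c1 ++ (move v st, X) :: c2).
Proof.
move=> vX fresh; rewrite disjoint_sum_split /=.
under [RHS]eq_bigr => st _ do rewrite disjoint_sum_split mulr_sumr.
rewrite [RHS]exchange_big /= big_seq [RHS]big_seq; apply: eq_bigr => a ha.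
rewrite paths_to_cons //; apply: eq_bigr => st _.
rewrite mulr_sumr; apply: eq_bigr => s _.
rewrite mulr_sumr big_seq [RHS]big_seq; apply: eq_bigr => b hb.
apply: disjoint_weight_cons => q qab.
have : q.1 \in map fst (c1 ++ c2).
  rewrite map_cat -(located_tuples_start ha) -(located_tuples_start hb) -map_cat.
  exact: map_f.
by case/mapP => e /fresh/andP[e1 e2] E; apply: notin_verts; rewrite E.
Qed.

(** The row of [v] has an entry for every end, and the first-step recursion applies to all of them
    only if [v] is none of these ends. *)
Lemma paths_det_rec k c1 v X c2 : size (c1 ++ (v, X) :: c2) = k ->
  {in c1 ++ (v, X) :: c2, forall e, v != (e.2, 0)%N} ->
  paths_det k (c1 ++ (v, X) :: c2) =
  \sum_(st <- steps | step_ok r m v.2 st)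
     step_weight r m R v.2 st * paths_det k (c1 ++ (move v st, X) :: c2).
Proof.
move=> sk vE.
have ik : (size c1 < k)%N by rewrite -sk size_cat /= addnS ltnS leq_addr.
pose i0 := Ordinal ik.
have nth2 w (j : nat) : (nth (0, 0, 0)%N (c1 ++ (w, X) :: c2) j).2
     = (nth (0, 0, 0)%N (c1 ++ (v, X) :: c2) j).2.
  by rewrite !nth_cat; case: ifP => //; case: (j - _)%N.
have nth1 w (j : nat) : (j != size c1)%N -> nth (0, 0, 0)%N (c1 ++ (w, X) :: c2) j
     = nth (0, 0, 0)%N (c1 ++ (v, X) :: c2) j.
  rewrite !nth_cat; case: ltnP => // jc jn.
  by case E: (j - _)%N => //; move: jn; lia.
have nthi w : nth (0, 0, 0)%N (c1 ++ (w, X) :: c2) i0 = (w, X).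
  by rewrite /= nth_cat ltnn subnn.
(* Cofactors along row [i0] do not see that row, hence do not depend on [w]. *)
pose cof w (j : 'I_k) := cofactor (\matrix_(i < k, j < k)
  paths_sum r m R (nth (0, 0, 0)%N (c1 ++ (w, X) :: c2) i).1
                  (nth (0, 0, 0)%N (c1 ++ (w, X) :: c2) j).2) i0 j.
have cofE w j : cof w j = cof v j.
  rewrite /cof /cofactor; congr (_ * \det _); apply/matrixP => i l.
  rewrite !mxE nth2 nth1 //; have := neq_lift i0 i.
  by rewrite -val_eqE /= eq_sym.
have detE w : paths_det k (c1 ++ (w, X) :: c2) = \sum_(j < k)
    paths_sum r m R w (nth (0, 0, 0)%N (c1 ++ (v, X) :: c2) j).2 * cof v j.
  rewrite /paths_det (expand_det_row _ i0); apply: eq_bigr => j _.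
  by rewrite -/(cof w j) cofE mxE nthi nth2.
rewrite detE; under [RHS]eq_bigr => st _ do rewrite detE mulr_sumr.
rewrite [RHS]exchange_big; apply: eq_bigr => j _ /=.
rewrite paths_sum_rec; first by rewrite mulr_suml; apply: eq_bigr => st _; rewrite mulrA.
by apply: vE; apply: mem_nth; rewrite sk.
Qed.

(** The last path is complete and no other vertex can reach its end, so the last column is a unit
    vector. *)
Lemma paths_det_rcons c X :
  {in c, forall e, (X <= e.1.1)%N && (e.1 != (X, 0)%N)} ->
  paths_det (size c).+1 (rcons c ((X, 0)%N, X)) = paths_det (size c) c.
Proof.
move=> late; rewrite /paths_det (expand_det_col _ ord_max) big_ord_recr /=.
rewrite big1 ?add0r => [|i _]; last first.
  rewrite mxE /= !nth_rcons ltn_ord ltnn eqxx /=.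
  have /late/andP[? ?] : nth (0, 0, 0)%N c i \in c by apply: mem_nth.
  by rewrite paths_sum_nil ?mul0r.
rewrite mxE !nth_rcons ltnn eqxx /= paths_sum_self mul1r /cofactor.
rewrite addnn -signr_odd odd_double mul1r; congr (\det _).
by apply/matrixP => i j; rewrite !mxE !lift_max !nth_rcons !ltn_ord.
Qed.

Lemma disjoint_sum_rcons c X :
  {in c, forall e, (X <= e.1.1)%N && (e.1 != (X, 0)%N)} ->
  disjoint_sum (rcons c ((X, 0)%N, X)) = disjoint_sum c.
Proof.
move=> late; rewrite -cats1 disjoint_sum_split /= paths_to_self.
rewrite /disjoint_sum big_seq [RHS]big_seq; apply: eq_bigr => a ha.
rewrite !big_seq1 /disjoint_weight cats1 big_rcons /= mulr1.
congr (if _ then _ else _).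
rewrite /vertex_disjoint pairwise_rcons; apply: andb_idl => _.
apply/allP => q qa; rewrite disjoint_pathsC /disjoint_paths /= andbT.
have : q.1 \in map fst c by rewrite -(located_tuples_start ha); apply: map_f.
case/mapP => e /late/andP[e1 e2] E; apply: notin_verts; rewrite E //.
by rewrite eq_sym.
Qed.

(** Every vertex has passed the last end, so the last column is zero. *)
Lemma paths_det_late c : (0 < size c)%N ->
  {in c, forall e, (last (0, 0, 0)%N c).2 < e.1.1}%N -> paths_det (size c) c = 0.
Proof.
case: c => // e0 c _ late.
rewrite /paths_det (expand_det_col _ ord_max) big1 // => i _; rewrite mxE.
have -> : nth (0, 0, 0)%N (e0 :: c) (@ord_max (size c)) = last (0, 0, 0)%N (e0 :: c).
  by rewrite -nth_last.
have /late lt : nth (0, 0, 0)%N (e0 :: c) i \in e0 :: c by apply: mem_nth.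
rewrite paths_sum_nil ?mul0r 1?ltnW //.
by apply: contraTneq lt => ->; rewrite ltnn.
Qed.

Lemma disjoint_sum_late c : (0 < size c)%N ->
  {in c, forall e, (last (0, 0, 0)%N c).2 < e.1.1}%N -> disjoint_sum c = 0.
Proof.
case/lastP: c => // c e _; rewrite last_rcons => late.
have /late lt : e \in rcons c e by rewrite mem_rcons mem_head.
rewrite -cats1 disjoint_sum_split big1 // => a _.
rewrite paths_to_nil ?big_nil 1?ltnW //.
by apply: contraTneq lt => ->; rewrite ltnn.
Qed.

(* Paths are listed from the outermost to the innermost one.  The second case is
   that of an inner path which has not left its starting point yet; the starting
   points have abscissa at most [B]. *)
Definition above (B : nat) (e f : nat * nat * nat) : bool :=
  (f.1.2 < e.1.2)%N || [&& f.1.2 == 0, e.1.1 < f.1.1 & f.1.1 <= B]%N.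

(** Third clause: apart from vertices on the ground up to [B], where paths may still wait, none is
    more than 2, the longest step, ahead of another. With the parity in the first clause, paths
    cannot change order without meeting in a vertex. *)
Definition sweep_inv (B : nat) c : Prop :=
  [/\ {in c, forall e, ~~ odd (e.1.1 + e.1.2) && (B <= e.2)%N},
      pairwise (above B) c,
      {in c &, forall e f, (e.1.2 == 0)%N && (e.1.1 <= B)%N || (e.1.1 <= f.1.1 + 2)%N}
    & pairwise (fun e f => f.2 < e.2)%N c].

Lemma above_uniq B c : pairwise (above B) c -> uniq (map fst c).
Proof.
rewrite uniq_pairwise pairwise_map; apply: sub_pairwise => -[[x h] X] [[y l] Y].
by rewrite /above /= xpair_eqE; lia.
Qed.

(** The critical move is a down step to the height of [f]. By parity [f] is then an odd distance
    ahead: distance 1 is a collision, and a larger one means that [f] waits on the ground, the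
    second case of [above]. *)
Lemma above_move_upper B e f st : step_ok r m e.1.2 st ->
  ~~ odd (e.1.1 + e.1.2) -> ~~ odd (f.1.1 + f.1.2) -> (e.1.1 <= f.1.1)%N ->
  (f.1.2 == 0)%N && (f.1.1 <= B)%N || (f.1.1 <= e.1.1 + 2)%N ->
  move e.1 st != f.1 -> above B e f -> above B (move e.1 st, e.2) f.
Proof.
case: e f => [[x h] X] [[y l] Y]; rewrite /above /move /= => ok.
have h0 : st = Fl -> (0 < h)%N by move: ok => /[swap] ->; case: (h).
by rewrite xpair_eqE; case: st ok h0 => /= ok h0; lia.
Qed.

(** Here [e] is strictly higher, hence not waiting and at most 2 ahead; by parity an up step to its
    height would collide with it. *)
Lemma above_move_lower B e f st : step_ok r m f.1.2 st ->
  ~~ odd (e.1.1 + e.1.2) -> ~~ odd (f.1.1 + f.1.2) -> (f.1.1 <= e.1.1)%N ->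
  (e.1.2 == 0)%N && (e.1.1 <= B)%N || (e.1.1 <= f.1.1 + 2)%N ->
  move f.1 st != e.1 -> above B e f -> above B e (move f.1 st, f.2).
Proof.
case: e f => [[x h] X] [[y l] Y]; rewrite /above /move /= => ok.
by rewrite xpair_eqE; case: st ok => /= ok; lia.
Qed.

Lemma sweep_inv_move B c1 v X c2 st :
  sweep_inv B (c1 ++ (v, X) :: c2) -> step_ok r m v.2 st ->
  {in c1 ++ (v, X) :: c2, forall e, v.1 <= e.1.1}%N ->
  uniq (map fst (c1 ++ (move v st, X) :: c2)) ->
  sweep_inv B (c1 ++ (move v st, X) :: c2).
Proof.
move=> [par ab gap ends] ok vmin.
rewrite map_cat /= cat_uniq /= negb_or -andbA => /and4P[_ n1 _ /andP[n2 _]].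
have sub e : e \in c1 ++ c2 -> e \in c1 ++ (v, X) :: c2.
  by rewrite !mem_cat inE => /orP[] ->; rewrite ?orbT.
have vin : (v, X) \in c1 ++ (v, X) :: c2 by rewrite mem_cat mem_head orbT.
have new e : e \in c1 ++ (move v st, X) :: c2 ->
    e = (move v st, X) \/ e \in c1 ++ c2.
  by rewrite !mem_cat inE => /or3P[->|/eqP|->]; rewrite ?orbT; auto.
have ne e : e \in c1 ++ c2 -> move v st != e.1.
  by rewrite mem_cat => /orP[] ein; [move: n1|move: n2]; apply: contraNneq => ->; apply: map_f.
have /andP[vpar vX] := par _ vin.
split.
- move=> e /new[->|/sub/par//] /=; rewrite vX andbT.
  by move: vpar ok; clear; case: v => x h; case: st => /=; lia.
- apply: pairwise_replace ab => e ein.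
    have ein' : e \in c1 ++ c2 by rewrite mem_cat ein.
    have /andP[? _] := par _ (sub _ ein').
    apply: (@above_move_lower _ e (v, X)) => //=; rewrite ?ne ?vmin ?sub //.
    exact: (gap e (v, X) (sub _ ein') vin).
  have ein' : e \in c1 ++ c2 by rewrite mem_cat ein orbT.
  have /andP[? _] := par _ (sub _ ein').
  apply: (@above_move_upper _ (v, X) e) => //=; rewrite ?ne ?vmin ?sub //.
  exact: (gap e (v, X) (sub _ ein') vin).
- move=> e f /new[->|/sub ein] /new[->|/sub fin] /=; apply/orP.
  + by right; rewrite leq_addr.
  + right; have := vmin _ fin; by case: (st) => /=; lia.
  + have /orP[|g] := gap _ _ ein vin; [by left|right].
    by apply: leq_trans g _; rewrite leq_add2r leq_addr.
  + exact/orP/gap.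
- by apply: pairwise_replace ends.
Qed.

Theorem paths_det_disjoint_sum B c : sweep_inv B c ->
  paths_det (size c) c = disjoint_sum c.
Proof.
(* The [.+1] makes the measure drop also when a finished path is removed. *)
have [u] := ubnP (\sum_(e <- c) (e.2.+1 - e.1.1))%N; elim: u c => // u IH c.
rewrite ltnS => cu inv.
have [/size0nil ->|c0] := posnP (size c).
  by rewrite /paths_det /disjoint_sum det_mx00 big_seq1 /disjoint_weight big_nil.
have [c1 [[v X] [c2 [cE /allP vmin]]]] := exists_min (fun e => e.1.1) c0.
set l := last (0, 0, 0)%N c.
have lc : l \in c by rewrite /l; case: (c) c0 => // e s _ /=; apply: mem_last.
have [par ab gap ends] := inv.
have [vl|vl] := eqVneq v (l.2, 0)%N.
  (* A path inside [v] would have to lie below height 0 or wait to the right of [l.2], which is at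
     least [B]. *)
  have c20 : c2 = [::].
    case: c2 cE => // e c2 cE.
    have lE : l \in e :: c2 by rewrite /l cE last_cat /= mem_last.
    have := ab; rewrite cE pairwise_cat pairwise_cons => /and3P[_ _ /andP[/allP/(_ _ lE)]].
    by have /andP[_] := par _ lc; rewrite /above vl /=; lia.
  have XE : X = l.2 by rewrite /l cE c20 last_cat.
  have cE' : c = rcons c1 ((X, 0)%N, X) by rewrite cE c20 -cats1 vl XE.
  have late : {in c1, forall e, (X <= e.1.1)%N && (e.1 != (X, 0)%N)}.
    move=> e ec; have := above_uniq ab; rewrite cE' map_rcons rcons_uniq => /andP[/= n _].
    have -> /= : (X <= e.1.1)%N.
      by have := vmin e; rewrite vl XE /=; apply; rewrite cE' mem_rcons inE ec orbT.
    by apply: contraNneq n => <-; apply: map_f.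
  rewrite cE' size_rcons paths_det_rcons // disjoint_sum_rcons //; apply: IH.
    by move: cu; rewrite cE' big_rcons /=; lia.
  have sub e : e \in c1 -> e \in c by rewrite cE' mem_rcons inE orbC => ->.
  split; first by move=> e /sub/par.
  - by move: ab; rewrite cE' pairwise_rcons => /andP[].
  - by move=> e f /sub ec /sub fc; apply: gap.
  - by move: ends; rewrite cE' pairwise_rcons => /andP[].
have [lv|vlX] := ltnP l.2 v.1.
  rewrite paths_det_late ?disjoint_sum_late // => e ec; apply: leq_trans lv _.
    exact: (vmin e).
  exact: (vmin e).
(* Ends decrease along [c], so [l.2] is the smallest one and [v] has reached none of them. *)
have vE : {in c, forall e, (v.1 <= e.2)%N && (v != (e.2, 0)%N)}.
  move=> e; move: (c) @l c0 {cu cE vmin lc inv par ab gap} ends vlX vl => {}c.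
  case/lastP: c => // c f; rewrite last_rcons pairwise_rcons => l _.
  case/andP => /allP fmin _ vf vf'; rewrite mem_rcons inE => /predU1P[->|/fmin /= fe].
    by rewrite vf.
  rewrite (leq_trans vf) ?(ltnW fe) //.
  by apply: contraTneq (leq_ltn_trans vf fe) => ->; rewrite ltnn.
have vin : (v, X) \in c by rewrite cE mem_cat mem_head orbT.
have /andP[vX vX0] := vE _ vin.
have fresh : {in c1 ++ c2, forall e, (v.1 <= e.1.1)%N && (v != e.1)}.
  move=> e ec; rewrite (vmin e) /=; last first.
    by rewrite cE mem_cat inE; move: ec; rewrite mem_cat => /orP[] ->; rewrite ?orbT.
  have := above_uniq ab; rewrite cE -cat1s !map_cat uniq_catCA -map_cat /= => /andP[+ _].
  by apply: contraNneq => ->; apply: map_f.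
have := @paths_det_rec (size c) c1 v X c2; rewrite -cE => -> //; last by move=> e /vE/andP[].
have := @disjoint_sum_rec c1 v X c2 vX0 fresh; rewrite -cE => ->; apply: eq_bigr => st ok; congr (_ * _).
set c' := c1 ++ (move v st, X) :: c2.
have sc : size c = size c' by rewrite cE !size_cat.
rewrite sc; have [u'|nu] := boolP (uniq (map fst c')); last first.
  by rewrite paths_det_collision // disjoint_sum_collision.
apply: IH; last by apply: sweep_inv_move => //; rewrite -cE.
apply: leq_trans cu; rewrite cE !big_cat !big_cons /= ltn_add2l ltn_add2r.
by move: vX; case: (st) => /=; lia.
Qed.
End Determinant.

(** * Nested paths and the Hankel determinant *)

Lemma tpathsE r m a b : tpaths r m a b = paths_to r m (a, 0%N) b.
Proof.
rewrite -(@filter_short_words _ _ _ _ (b - a).+1) /=; last by lia.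
apply: eq_filter => s; rewrite /is_path /= andbA; congr (_ && _); lia.
Qed.

Definition nested_config (k n : nat) : seq (nat * nat * nat) :=
  [seq ((2 * i - 2, 0), 2 * n + 2 * k - 2 * i)%N | i <- iota 1 k].

Lemma path_tuples_sum (F : fieldType) r m (R : nat -> int -> F) k n :
  \sum_(ps <- path_tuples r m k n | nonintersecting ps) tuple_weight r m R ps =
  disjoint_sum r m R (nested_config k n).
Proof.
pose g (p : nat * seq step) := ((p.1, 0%N), p.2).
have -> : disjoint_sum r m R (nested_config k n) =
    \sum_(ps <- path_tuples r m k n) disjoint_weight r m R (map g ps).
  rewrite -(big_map (map g) xpredT) -prodseq_map /disjoint_sum; congr bigop.
  rewrite /located_tuples; congr prodseq; rewrite -!map_comp.
  by apply: eq_map => i /=; rewrite -map_comp tpathsE.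
rewrite big_mkcond; apply: eq_bigr => ps _; rewrite /disjoint_weight big_map.
by rewrite /vertex_disjoint pairwise_map.
Qed.

(** The bound [2 * n] separates starts from ends: starts are at most [2 * k - 2], and the smallest
    end is [2 * n]. *)
Lemma nested_config_inv k n : (k.-1 <= n)%N -> sweep_inv (2 * n) (nested_config k n).
Proof.
move=> kn; have iotaP i : i \in iota 1 k -> (1 <= i <= k)%N by rewrite mem_iota; lia.
have lt : pairwise ltn (iota 1 k) by rewrite -(sorted_pairwise ltn_trans) iota_ltn_sorted.
split.
- by move=> _ /mapP[i /iotaP ik ->] /=; lia.
- rewrite pairwise_map; apply: sub_in_pairwise (allss _) lt => i j /iotaP ik /iotaP jk ij.
  by rewrite /above /=; lia.
- by move=> _ f /mapP[i /iotaP ik ->] _ /=; lia.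
- by rewrite pairwise_map; apply: sub_in_pairwise (allss _) lt => i j /iotaP ik /iotaP jk /=; lia.
Qed.

(** Path lengths decrease in [i + j] while Hankel indices increase; reversing rows and columns
    together costs no sign. *)
Lemma det_rev (F : comNzRingType) k (A : 'M[F]_k) :
  \det (\matrix_(i < k, j < k) A (rev_ord i) (rev_ord j)) = \det A.
Proof.
pose s := perm (@rev_ord_inj k).
rewrite (_ : \matrix_(i, j) _ = row_perm s (col_perm s A)); last first.
  by apply/matrixP => i j; rewrite !mxE !permE.
by rewrite row_permE col_permE !det_mulmx !det_perm mulrCA odd_permV -signr_addb addbb mulr1.
Qed.

Theorem mainTheorem13 (F : fieldType) (r : nat) (R : nat -> int -> F)
  (m : nat -> int) (k n : nat) :
  (1 <= r)%N ->
  QSystem r R ->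
  (forall (a : nat) (j : int), (1 <= a <= r)%N -> R a j != 0) ->
  ascMotzkin r m ->
  (1 <= k <= r)%N ->
  (k.-1 <= n)%N ->
  R k n%:Z =
    R 1%N 0 ^+ k *
    \sum_(ps <- path_tuples r m k n | nonintersecting ps)
       tuple_weight r m R ps.
Proof.
move=> _ qsys Rn0 motz kr kn.
rewrite path_tuples_sum -(paths_det_disjoint_sum _ _ _ (nested_config_inv kn)).
(* One factor [R 1 0] per row turns the path counts into moments. *)
rewrite size_map size_iota /paths_det -detZ.
have -> : R k n%:Z = R k ((n - k.-1)%N%:Z + k%:Z - 1) by congr (R k _); lia.
rewrite -(hankel_det qsys Rn0); last by case/andP: kr.
rewrite -[LHS]det_rev.
congr (\det _); apply/matrixP => i j; rewrite !mxE /=.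
rewrite !(nth_map 0%N) ?size_iota // !nth_iota //=.
(* No subtraction truncates, since [i] and [j] are at most [k.-1], hence at most [n]. *)
have -> : (2 * n + 2 * k - 2 * (1 + j) = 2 * (1 + i) - 2 + 2 * (n + k.-1 - i - j))%N.
  by have := ltn_ord i; have := ltn_ord j; lia.
rewrite (paths_sum_moment qsys Rn0 motz); congr (R _ _).
by have := ltn_ord i; have := ltn_ord j; lia.
Qed.
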